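(* Fix an integer $l\ge -1$. For every $g\ge 4l+3$, \[\#\{S\in\mathcal{S}_g\mid e(S)=g-l\}=\sum_{k=-1}^{l}\ \sum_{\substack{\overline{x}\in\mathcal{Y}(k)\\ a(\overline{x})+b(\overline{x})-c(\overline{x})=2k+1-l}}\binom{g-3k-2}{k+1-a(\overline{x})-2b(\overline{x})}.\]
   Context: A numerical semigroup $S$ is a submonoid of $\mathbb{N}_0$ with finite complement; its genus is the size of the complement and $e(S)$ is the size of its minimal generating set $(S\setminus\{0\})\setminus((S\setminus\{0\})+(S\setminus\{0\}))$. $\mathcal{S}_g$ is the set of numerical semigroups of genus $g$. For $\overline{x}=(x_1,\ldots,x_t)\in\{1,2,3\}^t$ let $a(\overline{x})=\#\{i: x_i=2\}$, $b(\overline{x})=\#\{i: x_i=3\}$, and $c(\overline{x})=\#\{i\in[1,t]: \exists j_1,j_2\in[1,t],\ j_1+j_2=i,\ (x_{j_1},x_{j_2},x_i)=(1,1,2)\}$. For an integer $k\ge 0$, $\mathcal{Y}(k)$ is the set of tuples $\overline{x}\in\{1,2,3\}^{2k+1}$ such that (i) whenever $i_1,i_2,i_3\in[1,2k+1]$ satisfy $i_1+i_2=i_3$, $(x_{i_1},x_{i_2},x_{i_3})\ne(1,1,3)$, and (ii) $a(\overline{x})+2b(\overline{x})\le k+1$; $\mathcal{Y}(-1)=\{\emptyset\}$ consists of the empty tuple (with $a=b=c=0$). *)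

(* Defs.v *)
From mathcomp Require Import all_boot all_order all_algebra.
From mathcomp Require Import finmap.
Set Implicit Arguments. Unset Strict Implicit. Unset Printing Implicit Defensive.
Import Order.TTheory GRing.Theory Num.Theory.

Local Open Scope fset_scope.

Definition has_card (T : eqType) (P : T -> Prop) (n : nat) : Prop :=
  exists s : seq T, [/\ uniq s, (forall x, P x <-> x \in s) & size s = n].

(* A numerical semigroup S is represented by its (finite) complement G = N \ S. *)
Definition inS (G : {fset nat}) (x : nat) : bool := x \notin G.

(* S = N \ G is a submonoid of (N,+) (its complement is finite by construction). *)
Definition is_numsgp (G : {fset nat}) : Prop :=
  inS G 0 /\ (forall x y, inS G x -> inS G y -> inS G (x + y)%N).

Definition genus (G : {fset nat}) : nat := #|` G|.

Definition mingen (G : {fset nat}) (x : nat) : Prop :=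
  [/\ inS G x, x != 0 &
      ~ (exists y z, [/\ inS G y, y != 0, inS G z, z != 0 & (y + z)%N = x])].

Definition embdim_is (G : {fset nat}) (n : nat) : Prop := has_card (mingen G) n.

(* Tuples x = (x_1,...,x_t) with entries encoded in 'I_4 (entries must lie in {1,2,3}).
   xat x i = x_i (1-based indexing). *)
Definition xat (x : seq 'I_4) (i : nat) : nat := nth 0 (map val x) i.-1.

Definition a_of (x : seq 'I_4) : nat := count (fun v : 'I_4 => val v == 2) x.
Definition b_of (x : seq 'I_4) : nat := count (fun v : 'I_4 => val v == 3) x.
Definition c_of (x : seq 'I_4) : nat :=
  let t := size x in
  count (fun i => [exists j1 : 'I_t.+1, exists j2 : 'I_t.+1,
           [&& 1 <= j1, 1 <= j2, (j1 + j2 == i)%N,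
               xat x j1 == 1, xat x j2 == 1 & xat x i == 2]])
        (iota 1 t).

Definition Ylen (k : int) : nat := if k is Posz m then (2 * m).+1 else 0.

Local Open Scope ring_scope.

Definition inY (k : int) (x : seq 'I_4) : bool :=
  if k == (-1)%R then x == [::] else
  [&& size x == Ylen k,
      all (fun v : 'I_4 => (1 <= val v)%N) x,
      [forall i1 : 'I_(size x).+1, forall i2 : 'I_(size x).+1, forall i3 : 'I_(size x).+1,
         [&& (1 <= i1)%N, (1 <= i2)%N, (1 <= i3)%N & (i1 + i2 == i3)%N] ==>
         ~~ [&& xat x i1 == 1%N, xat x i2 == 1%N & xat x i3 == 3%N]] &
      ((a_of x + 2 * b_of x)%N%:Z <= k + 1)%R].

Definition rhs810 (l : int) (g : nat) : nat :=
  \sum_(0 <= j < (absz (l + 1)).+1)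
    let k : int := (j%:Z - 1)%R in
    \sum_(x : (Ylen k).-tuple 'I_4 |
            inY k x &&
            ((a_of x)%:Z + (b_of x)%:Z - (c_of x)%:Z == 2 * k + 1 - l)%R)
      'C(absz (g%:Z - 3 * k - 2)%R, absz (k + 1 - (a_of x)%:Z - 2 * (b_of x)%:Z)%R).

(* Main.v *)
Require Import Defs.
From mathcomp Require Import all_boot all_order all_algebra.
From mathcomp Require Import finmap zify.
Set Implicit Arguments. Unset Strict Implicit. Unset Printing Implicit Defensive.
Import Order.TTheory GRing.Theory Num.Theory.

(** A semigroup of genus [g] and multiplicity [m = g - k] has Kunz coordinates
    [x_1, ..., x_(m-1) >= 1] with excess [sum (x_i - 1) = k + 1], and [e(S) = m - d]
    where [d] counts the decomposable Apery elements; so [e(S) = g - l] means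
    [d = l - k], whence [k <= l] and [m >= 3 (k + 1)]. For such [m], summing the Kunz
    inequalities at [i] over all pairs of indices adding up to [i] modulo [m], and
    comparing with the excess, shows that every [x_i <= 3], that [x_i = 3] only for
    [i <= 2k + 1], that every [3] is decomposable, and that so is every [2] beyond
    position [2k + 1]. Hence S is given by a tuple in Y(k) and a free choice of
    [k + 1 - a - 2b] positions of [2]s beyond [2k + 1], and [d = c + b + (k + 1 - a - 2b)]. *)

(** * Cardinalities of predicates *)

Lemma has_card_iff (T : eqType) (P Q : T -> Prop) (n : nat) :
  (forall x, P x <-> Q x) -> has_card P n -> has_card Q n.
Proof.
move=> PQ [s [us sP <-]]; exists s; split=> // x.
by split=> [/PQ/sP//|/sP/PQ].
Qed.

Lemma has_card_unique (T : eqType) (P : T -> Prop) (n1 n2 : nat) :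
  has_card P n1 -> has_card P n2 -> n1 = n2.
Proof.
move=> [s1 [u1 P1 <-]] [s2 [u2 P2 <-]]; apply/perm_size/uniq_perm => // x.
by apply/idP/idP => [/P1/P2|/P2/P1].
Qed.

Lemma has_card_image (T U : eqType) (P : T -> Prop) (f : T -> U) (n : nat) :
  (forall x y, P x -> P y -> f x = f y -> x = y) ->
  has_card P n -> has_card (fun u => exists2 x, P x & u = f x) n.
Proof.
move=> inj [s [us sP <-]]; exists (map f s); split; last exact: size_map.
- by rewrite map_inj_in_uniq // => x y /sP Px /sP Py; apply: inj.
- by move=> u; split=> [[x /sP xs ->]|/mapP[x /sP Px ->]]; [exact: map_f|exists x].
Qed.

(** Disjointness is asked of [P] alone, so side conditions that it relies on are put inside [P]. *)
Lemma has_card_bigU (I T : eqType) (r : seq I) (A : pred I)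
    (P : I -> T -> Prop) (n : I -> nat) :
  uniq r ->
  (forall i, i \in r -> A i -> has_card (P i) (n i)) ->
  (forall i1 i2 x, i1 \in r -> i2 \in r -> P i1 x -> P i2 x -> i1 = i2) ->
  has_card (fun x => exists i, [/\ i \in r, A i & P i x])
           (\sum_(i <- r | A i) n i).
Proof.
elim: r => [|i r IHr] /=.
  by move=> _ _ _; exists [::]; rewrite big_nil; split=> // x; split=> // -[j []].
case/andP=> ir ur cardP disjP.
have [|j jr|j1 j2 x j1r j2r|s [us sP ss]] // := IHr.
- by apply: cardP; rewrite inE jr orbT.
- by apply: disjP; rewrite inE ?j1r ?j2r orbT.
rewrite big_cons; case: ifPn => Ai; last first.
  exists s; split=> // x; split=> [[j [/predU1P[->|jr] Aj Pjx]]|/sP[j [jr Aj Pjx]]].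
  - by rewrite Aj in Ai.
  - by apply/sP; exists j.
  - by exists j; rewrite inE jr orbT.
have [t [ut tP tt]] := cardP i (mem_head _ _) Ai.
exists (t ++ s); rewrite size_cat ss tt; split=> //.
  rewrite cat_uniq ut us andbT; apply/hasPn => x /sP[j [jr _ Pjx]].
  apply/negP => /= /tP Pix; move: ir.
  by rewrite (disjP i j x) ?jr ?mem_head // inE jr orbT.
move=> x; rewrite mem_cat; split=> [[j [/predU1P[->|jr] Aj Pjx]]|/orP[/tP Pix|/sP[j [jr Aj Pjx]]]].
- by move/tP: Pjx => ->.
- by apply/orP; right; apply/sP; exists j.
- by exists i; rewrite mem_head.
- by exists j; rewrite inE jr orbT.
Qed.

(** * Kunz coordinates *)

(* [kunz m k G]: the semigroup N \ G has multiplicity [m], and its smallest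
   element congruent to [i] modulo [m] is [apery m k i] for [i < m]. *)
Definition kunz (m : nat) (k : nat -> nat) (G : {fset nat}) : Prop :=
  [/\ 0 < m, k 0 = 0, forall i, 0 < i < m -> 0 < k i &
      forall x, (x \in G) = (x %/ m < k (x %% m))].

Definition apery (m : nat) (k : nat -> nat) (i : nat) : nat := k i * m + i.

(** Index 0 is excluded because its Apery element is 0. *)
Definition decomposable (m : nat) (k : nat -> nat) (i : nat) : bool :=
  [exists j1 : 'I_m, exists j2 : 'I_m,
     [&& 0 < j1, 0 < j2 & apery m k j1 + apery m k j2 == apery m k i]].

Definition gap_seq (m : nat) (k : nat -> nat) : seq nat :=
  [seq q * m + i | i <- iota 0 m, q <- iota 0 (k i)].

Definition gap_set (m : nat) (k : nat -> nat) : {fset nat} :=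
  [fset x in gap_seq m k]%fset.

(** These say that sums of Apery elements stay in the semigroup; passing [m] causes a carry, hence
    the successor. The case [i + j = m] would only bound [k 0 = 0]. *)
Definition kunz_ineq (m : nat) (k : nat -> nat) : Prop :=
  (forall i j, 0 < i -> 0 < j -> i + j < m -> k (i + j) <= k i + k j) /\
  (forall i j, i < m -> j < m -> m < i + j -> k (i + j - m) <= (k i + k j).+1).

Lemma mem_gap_seq m k x : 0 < m -> (x \in gap_seq m k) = (x %/ m < k (x %% m)).
Proof.
move=> m0; apply/allpairsPdep/idP => [[i [q []]]|xk].
  rewrite !mem_iota !add0n /= => im qk ->.
  by rewrite divnMDl // divn_small // addn0 modnMDl modn_small.
exists (x %% m), (x %/ m); rewrite !mem_iota !add0n /= ltn_mod m0.
by split=> //; rewrite -divn_eq.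
Qed.

Lemma kunz_gap_set m k :
  0 < m -> k 0 = 0 -> (forall i, 0 < i < m -> 0 < k i) -> kunz m k (gap_set m k).
Proof. by move=> m0 k0 kp; split=> // x; rewrite !inE mem_gap_seq. Qed.

Lemma kunz_gap_setE m k G : kunz m k G -> G = gap_set m k.
Proof. by case=> m0 _ _ GE; apply/fsetP => x; rewrite !inE mem_gap_seq. Qed.

Lemma kunz_congr m k k' G :
  {in gtn m, k =1 k'} -> kunz m k G -> kunz m k' G.
Proof.
move=> kk' [m0 k0 kp GE]; split=> // [|i im|x].
- by rewrite -kk'.
- by rewrite -kk' ?kp // inE; case/andP: im.
- by rewrite GE kk' // inE ltn_mod.
Qed.

(** The multiplicity is the least nonzero element, and [k i] counts the gaps congruent to [i]. *)
Lemma kunz_unique m1 k1 m2 k2 G :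
  kunz m1 k1 G -> kunz m2 k2 G -> m1 = m2 /\ {in gtn m1, k1 =1 k2}.
Proof.
move=> [p1 z1 kp1 G1] [p2 z2 kp2 G2].
have wlog_le m m' k k' : 0 < m -> k 0 = 0 -> 0 < m' ->
    (forall i, 0 < i < m' -> 0 < k' i) ->
    (forall x, (x \in G) = (x %/ m < k (x %% m))) ->
    (forall x, (x \in G) = (x %/ m' < k' (x %% m'))) -> m' <= m.
  move=> p z p' kp' GE GE'; rewrite leqNgt; apply/negP => mm'.
  (* If [m < m'], then [m] is an element by the first description and a gap by the second. *)
  move: (GE m); rewrite GE' modnn z ltn0 modn_small // divn_small // kp' //.
  by rewrite p.
have mm : m1 = m2 by apply/eqP; rewrite eqn_leq (wlog_le m1 m2 k1 k2) ?(wlog_le m2 m1 k2 k1).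
subst m2; split=> // i; rewrite inE => im.
have kE q : (q < k1 i) = (q < k2 i).
  by move: (G1 (q * m1 + i)); rewrite G2 divnMDl // divn_small // addn0 modnMDl modn_small.
by have := kE (k1 i); have := kE (k2 i); lia.
Qed.

Lemma size_gap_seq m k : size (gap_seq m k) = \sum_(0 <= i < m) k i.
Proof.
rewrite size_allpairs_dep sumnE big_map /index_iota subn0.
by apply: eq_bigr => i _; rewrite size_iota.
Qed.

Lemma gap_seq_uniq m k : uniq (gap_seq m k).
Proof.
apply: allpairs_uniq_dep; [exact: iota_uniq|by move=> i _; exact: iota_uniq|].
move=> _ _ /allpairsPdep[i1 [q1 [+ _ ->]]] /allpairsPdep[i2 [q2 [+ _ ->]]] /=.
rewrite !mem_iota !add0n /= => i1m i2m E.
have m0 : 0 < m by apply: leq_ltn_trans i1m.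
have ii : i1 = i2 by have := congr1 (modn^~ m) E; rewrite /= !modnMDl !modn_small.
subst i2; have := congr1 (divn^~ m) E.
by rewrite /= !divnMDl // divn_small // !addn0 => ->.
Qed.

Lemma kunz_genus m k G : kunz m k G -> genus G = \sum_(1 <= i < m) k i.
Proof.
move=> kG; rewrite (kunz_gap_setE kG); case: kG => m0 k0 _ _.
transitivity (size (gap_seq m k)).
  apply/perm_size/uniq_perm; [exact: fset_uniq|exact: gap_seq_uniq|].
  by move=> x; rewrite !inE.
by rewrite size_gap_seq big_ltn // k0.
Qed.

Lemma leq_sum_mem (s : seq nat) x : x \in s -> x <= \sum_(y <- s) y.
Proof. by move=> xs; rewrite (big_rem _ xs) leq_addr. Qed.

(** Closure under adding [m] makes membership in a residue class monotone in the quotient, so the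
    least quotient describes the class. *)
Lemma numsgp_kunz G : is_numsgp G -> exists m k, kunz m k G.
Proof.
case=> S0 SD.
have exm : exists x, (0 < x) && inS G x.
  (* One more than the sum of all gaps exceeds every gap. *)
  exists (\sum_(y <- G) y).+1; rewrite /=; apply/negP => /leq_sum_mem.
  by rewrite ltnn.
have [m /andP[m0 Sm] mmin] := ex_minnP exm.
have SM q x : inS G x -> inS G (q * m + x).
  by move=> Sx; elim: q => [//|q IH]; rewrite mulSn -addnA SD.
have exk i : exists q, inS G (q * m + i).
  exists (\sum_(y <- G) y).+1; apply/negP => /leq_sum_mem.
  by rewrite leqNgt (leq_trans _ (leq_addr _ _)) // leq_pmulr.
pose k i := ex_minn (exk i); exists m, k.
have kP i q : (q * m + i \in G) = (q < k i).
  rewrite /k; case: ex_minnP => q0 Sq0 q0min; rewrite ltnNge.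
  apply/idP/negP => [qG|]; last by apply: contra_notT => /q0min.
  move=> q0q; have := SM (q - q0) _ Sq0.
  by rewrite addnA -mulnDl subnK // /inS qG.
split=> // [|i /andP[i0 im]|x].
- by apply/eqP; rewrite -leqn0 leqNgt -kP mul0n.
- rewrite -kP mul0n add0n; apply/negPn/negP => Si.
  by have := mmin i; rewrite i0 /inS Si => /(_ isT); rewrite leqNgt im.
- by rewrite {1}(divn_eq x m) kP.
Qed.

(** * Closure under addition and the Kunz inequalities *)

Lemma kunz_inS m k G i q : kunz m k G -> i < m -> inS G (q * m + i) = (k i <= q).
Proof.
move=> [m0 _ _ GE] im.
by rewrite /inS GE divnMDl // divn_small // addn0 modnMDl modn_small // -leqNgt.
Qed.

(** Every element is an Apery element plus a multiple of [m], so closure need only be tested on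
    Apery elements. *)
Lemma kunz_numsgp m k G : kunz m k G -> is_numsgp G <-> kunz_ineq m k.
Proof.
move=> kG; have inSE := fun i q => @kunz_inS m k G i q kG.
case: (kG) => m0 k0 kp GE; split=> [[S0 SD]|[le1 le2]].
  have Sa i : i < m -> inS G (k i * m + i) by move=> im; rewrite inSE.
  split=> [i j i0 j0 ij|i j im jm ij].
    have := SD _ _ (Sa i ltac:(lia)) (Sa j ltac:(lia)).
    by rewrite (_ : _ + _ = (k i + k j) * m + (i + j)) ?inSE //; nia.
  have := SD _ _ (Sa i im) (Sa j jm).
  rewrite (_ : _ + _ = (k i + k j).+1 * m + (i + j - m)) ?inSE //; nia.
split; first by rewrite /inS GE div0n mod0n k0.
move=> x y; rewrite (divn_eq x m) (divn_eq y m).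
have := ltn_pmod x m0; have := ltn_pmod y m0.
move: (x %% m) (y %% m) (x %/ m) (y %/ m) => i j p q jm im.
rewrite !inSE // => kip kjq.
have [i0|i0] := posnP i.
  by rewrite i0 addn0 addnA -mulnDl inSE //; lia.
have [j0|j0] := posnP j.
  by rewrite j0 addn0 addnAC -mulnDl inSE //; lia.
have [ij|ij|ij] := ltngtP (i + j) m.
- rewrite (_ : _ + _ = (p + q) * m + (i + j)); last by nia.
  by rewrite inSE //; have := le1 i j i0 j0 ij; lia.
- rewrite (_ : _ + _ = (p + q).+1 * m + (i + j - m)); last by nia.
  by rewrite inSE; [have := le2 i j im jm ij|]; lia.
- rewrite (_ : _ + _ = (p + q).+1 * m + 0); last by nia.
  by rewrite inSE // k0.
Qed.

(** * Minimal generators and embedding dimension *)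

Lemma apery_inS m k G i : kunz m k G -> i < m -> inS G (apery m k i).
Proof. by move=> kG im; rewrite /apery (kunz_inS _ kG). Qed.

Lemma apery_inj m k : {in gtn m &, injective (apery m k)}.
Proof.
move=> i j; rewrite !inE => im jm /(congr1 (modn^~ m)).
by rewrite /apery /= !modnMDl !modn_small.
Qed.

(** A nonzero element [x] other than [m] splits as [(x - m) + m] if [x - m] is in the semigroup;
    otherwise [x] is an Apery element, and so are its nonzero summands. *)
Lemma mingen_apery m k G x : kunz m k G -> is_numsgp G ->
  mingen G x <-> x = m \/ exists i, [/\ 0 < i < m, ~~ decomposable m k i & x = apery m k i].
Proof.
move=> kG [S0 SD]; have inSE := fun i q => @kunz_inS m k G i q kG.
case: (kG) => m0 k0 kp GE.
have Sm : inS G m by rewrite -[m in inS G m]addn0 -[m in m + _]mul1n inSE // k0.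
have mmin y : inS G y -> y != 0 -> m <= y.
  rewrite leqNgt => Sy y0; apply/negP => ym; move: Sy.
  by rewrite /inS GE divn_small // modn_small // kp // lt0n y0.
(* A summand of an Apery element is again one: otherwise subtract [m] from it. *)
have summand i y z : i < m -> inS G y -> y != 0 -> inS G z -> y + z = apery m k i ->
    0 < y %% m /\ y = apery m k (y %% m).
  move=> im Sy y0 Sz E.
  have ym := mmin y Sy y0.
  have nS : ~~ inS G (y - m).
    apply/negP => Sym; have := SD _ _ Sym Sz.
    have ki : 0 < k i.
      rewrite lt0n; apply/negP => /eqP ki0.
      by move: E; rewrite /apery ki0 mul0n add0n; lia.
    rewrite (_ : y - m + z = (k i).-1 * m + i) ?inSE //; first lia.
    by move: E; rewrite /apery; case: (k i) ki => // q _; rewrite mulSn; lia.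
  have yd := divn_eq y m; have yi := ltn_pmod y m0.
  move: Sy nS; rewrite {1 2}yd inSE // => ky.
  have d0 : 0 < y %/ m by rewrite divn_gt0.
  rewrite (_ : _ - _ = (y %/ m).-1 * m + y %% m); last first.
    by case: (y %/ m) d0 => // q _; rewrite mulSn; lia.
  rewrite inSE // => nky.
  have kE : k (y %% m) = y %/ m by lia.
  split; last by rewrite /apery kE.
  by rewrite lt0n; apply/negP => /eqP e0; move: kE; rewrite e0 k0; lia.
split.
  case=> Sx x0 nx; have xm := mmin x Sx x0.
  have [Sxm|nSxm] := boolP (inS G (x - m)).
    left; apply/eqP/negPn/negP => xneq; apply: nx; exists (x - m), m; split=> //; lia.
  right; exists (x %% m).
  have xd := divn_eq x m; have xi := ltn_pmod x m0.
  have d0 : 0 < x %/ m by rewrite divn_gt0.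
  move: Sx nSxm; rewrite {1 2}xd inSE // => kx.
  rewrite (_ : _ - _ = (x %/ m).-1 * m + x %% m); last first.
    by case: (x %/ m) d0 => // q _; rewrite mulSn; lia.
  rewrite inSE // => nkx.
  have kE : k (x %% m) = x %/ m by lia.
  have xE : x = apery m k (x %% m) by rewrite /apery kE.
  split=> //.
    rewrite xi andbT lt0n; apply/negP => /eqP e0; move: kE; rewrite e0 k0; lia.
  apply/negP => /existsP[j1 /existsP[j2 /and3P[j10 j20 /eqP E]]]; apply: nx.
  exists (apery m k j1), (apery m k j2); rewrite -xE in E; split=> //;
    rewrite ?apery_inS // /apery; lia.
case=> [->|[i [/andP[i0 im] nd ->]]].
  split=> //; first by rewrite -lt0n.
  by case=> y [z [Sy y0 Sz z0 E]]; have := mmin _ Sy y0; have := mmin _ Sz z0; lia.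
split; [exact: apery_inS|by rewrite /apery; lia|].
case=> y [z [Sy y0 Sz z0 E]]; move/negP: nd; apply.
have [y1 yE] := summand i y z im Sy y0 Sz E.
rewrite addnC in E; have [z1 zE] := summand i z y im Sz z0 Sy E.
apply/existsP; exists (Ordinal (ltn_pmod y m0)); apply/existsP.
by exists (Ordinal (ltn_pmod z m0)); rewrite /= y1 z1 -yE -zE addnC E eqxx.
Qed.

Lemma kunz_embdim m k G : kunz m k G -> is_numsgp G ->
  has_card (mingen G) (m - \sum_(1 <= i < m) decomposable m k i).
Proof.
move=> kG nG; case: (kG) => m0 k0 kp _.
pose s := [seq i <- index_iota 1 m | ~~ decomposable m k i].
have sP i : i \in s -> 0 < i < m by rewrite mem_filter mem_index_iota => /andP[].
exists (m :: [seq apery m k i | i <- s]); split.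
- have us : uniq s by rewrite filter_uniq ?iota_uniq.
  rewrite /= map_inj_in_uniq ?us ?andbT; last first.
    by move=> i j /sP/andP[_ im] /sP/andP[_ jm]; apply: apery_inj.
  apply/negP => /mapP[i /sP/[dup]/kp ki /andP[i0 im]].
  by rewrite /apery => E; nia.
- move=> x; rewrite (mingen_apery _ kG nG) inE; split=> [[->|[i [im nd ->]]]|].
  + by rewrite eqxx.
  + by apply/orP; right; apply: map_f; rewrite mem_filter nd mem_index_iota.
  + case/orP=> [/eqP->|/mapP[i is_ ->]]; [by left|right; exists i].
    by split=> //; [exact: sP|move: is_; rewrite mem_filter => /andP[]].
- rewrite /= size_map size_filter.
  have := count_predC (decomposable m k) (index_iota 1 m).
  rewrite size_iota -sum1_count big_mkcond /= => cE.
  have -> : \sum_(1 <= i < m) decomposable m k i =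
            \sum_(1 <= i < m) (if decomposable m k i then 1 else 0).
    by apply: eq_bigr => i _; case: (decomposable _ _ _).
  rewrite (_ : count _ _ = count (predC (decomposable m k)) (index_iota 1 m)) //.
  by lia.
Qed.

(** Comparing quotients and remainders modulo [m], decomposability is equality in some Kunz
    inequality at [i]; indecomposability makes them all strict. *)
Lemma decomposableP m k i : 0 < i < m ->
  reflect (exists j1 j2, [/\ 0 < j1 < m, 0 < j2 < m &
             (j1 + j2 = i /\ k j1 + k j2 = k i) \/
             (j1 + j2 = i + m /\ (k j1 + k j2).+1 = k i)])
          (decomposable m k i).
Proof.
case/andP=> i0 im; apply: (iffP existsP) => [[j1 /existsP[j2]]|].
  case/and3P=> j10 j20 /eqP E; exists j1, j2.
  rewrite j10 j20 !ltn_ord; split=> //.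
  have := ltn_ord j1; have := ltn_ord j2; move: E j10 j20; rewrite /apery.
  move: (nat_of_ord j1) (nat_of_ord j2) => p q E p0 q0 qm pm.
  have m0 : 0 < m by apply: leq_ltn_trans im.
  have [pq|pq] := ltnP (p + q) m; [left|right].
    have E' : (k p + k q) * m + (p + q) = k i * m + i by nia.
    have /= := congr1 (modn^~ m) E'; have /= := congr1 (divn^~ m) E'.
    by rewrite !divnMDl // !modnMDl !modn_small // !divn_small // !addn0.
  have E' : (k p + k q).+1 * m + (p + q - m) = k i * m + i by nia.
  have pqm : p + q - m < m by lia.
  have /= := congr1 (modn^~ m) E'; have /= := congr1 (divn^~ m) E'.
  rewrite !divnMDl // !modnMDl !modn_small // !divn_small // !addn0; lia.
case=> j1 [j2 [/andP[j10 j1m] /andP[j20 j2m] E]].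
exists (Ordinal j1m); apply/existsP; exists (Ordinal j2m).
rewrite /= j10 j20 /apery /=; apply/eqP; case: E => -[Ei Ek]; rewrite -Ek; nia.
Qed.

(** * Kunz coordinates of small excess *)

Lemma sum_nat_ge_const (f : nat -> nat) m n c :
  (forall p, m <= p < n -> c <= f p) -> (n - m) * c <= \sum_(m <= p < n) f p.
Proof.
move=> cf; rewrite -sum_nat_const_nat big_seq [leqRHS]big_seq.
by apply: leq_sum => p; rewrite mem_index_iota => /cf.
Qed.

(* Pairing [p] with [i - p] below [i], and with [m + i - p] above [i]. *)
Lemma convolution_bound (f : nat -> nat) m i c d : 0 < i < m ->
  (forall p, 0 < p < i -> c <= f p + f (i - p)) ->
  (forall p, i < p < m -> d <= f p + f (m + i - p)) ->
  (i - 1) * c + (m - i.+1) * d + 2 * f i <= 2 * \sum_(1 <= p < m) f p.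
Proof.
case/andP=> i0 im lec led.
rewrite (@big_cat_nat _ _ _ i) //=; last exact: ltnW.
rewrite [\sum_(i <= p < m) _]big_ltn //.
have h1 : (i - 1) * c <= 2 * \sum_(1 <= p < i) f p.
  rewrite mul2n -addnn {2}big_nat_rev -big_split /=.
  by apply: sum_nat_ge_const => p pi; rewrite add1n subSS lec.
have h2 : (m - i.+1) * d <= 2 * \sum_(i.+1 <= p < m) f p.
  rewrite mul2n -addnn {2}big_nat_rev -big_split /=.
  apply: sum_nat_ge_const => p pi; rewrite addSn subSS [i + m]addnC.
  exact: led.
by lia.
Qed.

Section SmallExcess.

Variables (m j : nat) (k : nat -> nat).
Hypotheses (kpos : forall i, 0 < i < m -> 0 < k i) (kineq : kunz_ineq m k).
Hypotheses (ksum : \sum_(1 <= i < m) (k i).-1 = j) (jm : 3 * j <= m).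

(** This is the convolution bound for [k p - 1]: each pair loses 2, and the total is the excess. *)
Lemma kunz_bound i c d : 0 < i < m ->
  (forall p, 0 < p < i -> c.+2 <= k p + k (i - p)) ->
  (forall p, i < p < m -> d.+2 <= k p + k (m + i - p)) ->
  (i - 1) * c + (m - i.+1) * d + 2 * (k i).-1 <= 2 * j.
Proof.
move=> im lec led; rewrite -ksum.
apply: (convolution_bound (f := fun p => (k p).-1)) => // p pi.
- have := lec p pi; have := @kpos p; have := @kpos (i - p); lia.
- have := led p pi; have := @kpos p; have := @kpos (m + i - p); lia.
Qed.

Lemma kunz_le1 i p : 0 < i < m -> 0 < p < i -> k i <= k p + k (i - p).
Proof.
move=> im pi; have := kineq.1 p (i - p).
by rewrite subnKC; last lia; apply; lia.
Qed.

Lemma kunz_le2 i p : 0 < i < m -> i < p < m -> k i <= (k p + k (m + i - p)).+1.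
Proof.
move=> im pi; have := kineq.2 p (m + i - p).
by rewrite (_ : p + _ - m = i); last lia; apply; lia.
Qed.

Lemma kunz_le3 i : 0 < i < m -> k i <= 3.
Proof.
move=> im; rewrite leqNgt; apply/negP => ki.
have b1 p : 0 < p < i -> 3 <= k p + k (i - p).
  by move=> pi; have := kunz_le1 im pi; lia.
have b2 p : i < p < m -> 3 <= k p + k (m + i - p).
  by move=> pi; have := kunz_le2 im pi; lia.
(* Here [c = d = 1] gives [m + 4 <= 2 * j], against [3 * j <= m]. *)
by have := kunz_bound im b1 b2; lia.
Qed.

Lemma kunz_eq3_lt i : 0 < i < m -> k i = 3 -> i < (2 * j).-1.
Proof.
move=> im ki.
have b1 p : 0 < p < i -> 3 <= k p + k (i - p).
  by move=> pi; have := kunz_le1 im pi; lia.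
have b2 p : i < p < m -> 2 <= k p + k (m + i - p).
  by move=> pi; have := @kpos p; have := @kpos (m + i - p); lia.
(* Here [c = 1] and [d = 0] give [i + 3 <= 2 * j]. *)
by have := kunz_bound im b1 b2; lia.
Qed.

Lemma kunz_eq3_decomposable i : 0 < i < m -> k i = 3 -> decomposable m k i.
Proof.
move=> im ki; case: (decomposableP k im) => [//|nd]; exfalso.
have b1 p : 0 < p < i -> 4 <= k p + k (i - p).
  move=> pi; have := kunz_le1 im pi; rewrite ki leq_eqVlt => /orP[/eqP E|//].
  by case: nd; exists p, (i - p); split; [lia|lia|left; lia].
have b2 p : i < p < m -> 3 <= k p + k (m + i - p).
  move=> pi; have := kunz_le2 im pi; rewrite ki ltnS leq_eqVlt => /orP[/eqP E|//].
  by case: nd; exists p, (m + i - p); split; [lia|lia|right; lia].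
(* Here [c = 2] and [d = 1] give [m + i + 1 <= 2 * j]. *)
by have := kunz_bound im b1 b2; lia.
Qed.

(** Only pairs below [i] gain from indecomposability, since a carry would already make [k i] at
    least 3. *)
Lemma kunz_eq2_decomposable i :
  0 < i < m -> (2 * j).-1 < i -> k i = 2 -> decomposable m k i.
Proof.
move=> im ij ki; case: (decomposableP k im) => [//|nd]; exfalso.
have b1 p : 0 < p < i -> 3 <= k p + k (i - p).
  move=> pi; have := kunz_le1 im pi; rewrite ki leq_eqVlt => /orP[/eqP E|//].
  by case: nd; exists p, (i - p); split; [lia|lia|left; lia].
have b2 p : i < p < m -> 2 <= k p + k (m + i - p).
  by move=> pi; have := @kpos p; have := @kpos (m + i - p); lia.
(* Here [c = 1] and [d = 0] give [i + 1 <= 2 * j], which is exactly the cutoff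
   [2 * j - 1 = 2k + 1]. *)
by have := kunz_bound im b1 b2; lia.
Qed.

Lemma decomposable_ge2 i : 0 < i < m -> decomposable m k i -> 2 <= k i.
Proof.
move=> im /(decomposableP _ im)[p [q [pm qm E]]].
by have := kpos pm; have := kpos qm; lia.
Qed.

Lemma sum_decomposable : 0 < m ->
  \sum_(1 <= i < m) decomposable m k i =
    \sum_(1 <= i < (2 * j).-1.+1) (decomposable m k i && (k i == 2))
    + \sum_(1 <= i < (2 * j).-1.+1) (k i == 3)
    + \sum_((2 * j).-1.+1 <= i < m) (k i == 2).
Proof.
(* For [j = 0] the predecessor truncates, the cutoff is 1, and [0 < m] is used. *)
move=> m0; have tm : (2 * j).-1.+1 <= m by lia.
rewrite (@big_cat_nat _ _ _ (2 * j).-1.+1) //=; congr (_ + _).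
  rewrite -big_split /=; apply: eq_big_nat => i it.
  have im : 0 < i < m by lia.
  have := kunz_le3 im; have := @decomposable_ge2 i im.
  have := @kunz_eq3_decomposable i im.
  by case: (k i) => [|[|[|[|]]]] //; case: (decomposable _ _ _) => //= h1 h2 _;
    by [have := h2 isT | have := h1 erefl].
apply: eq_big_nat => i it; have im : 0 < i < m by lia.
have := kunz_le3 im; have := @decomposable_ge2 i im.
have := @kunz_eq3_lt i im; have := @kunz_eq2_decomposable i im.
case: (k i) => [|[|[|[|]]]] //; case: (decomposable _ _ _) => //= h1 h2 h3 h4 //; lia.
Qed.

End SmallExcess.

(** * Coordinates from tuples *)

Lemma count_xat (p : pred nat) (x : seq 'I_4) :
  count (fun v : 'I_4 => p (val v)) x = \sum_(1 <= i < (size x).+1) p (xat x i).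
Proof.
rewrite big_add1 /= -(count_map val p) -sum1_count big_mkcond (big_nth 0) size_map.
by apply: eq_bigr => i _; rewrite /xat /=; case: (p _).
Qed.

(** The set [z] records the free choice of 2s past the tuple, counted from position [size x + 1];
    the value 0 at index 0 is the one [kunz] prescribes. *)
Definition extend (n : nat) (x : seq 'I_4) (z : {set 'I_n}) (i : nat) : nat :=
  if i == 0 then 0
  else if i <= size x then xat x i
  else if [exists o in z, val o == i - (size x).+1] then 2 else 1.

Section Extend.

Variables (n : nat) (x : seq 'I_4) (z : {set 'I_n}).
Local Notation t := (size x).
Local Notation k := (extend x z).

Lemma extend_low i : 0 < i <= t -> k i = xat x i.
Proof. by rewrite /extend => /andP[i0 ->]; rewrite gtn_eqF. Qed.

Lemma extend_high o : k (t.+1 + val o) = (o \in z).+1.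
Proof.
rewrite /extend addSn /= leqNgt ltnS leq_addr /= subSS addKn.
have [oz|oz] := boolP (o \in z).
  by rewrite ifT //; apply/existsP; exists o; rewrite oz /=.
by rewrite ifF //; apply/existsP => -[o' /andP[oz' /eqP/val_inj E]]; rewrite -E oz' in oz.
Qed.

Lemma extend_high_le2 i : t < i -> 1 <= k i <= 2.
Proof.
move=> ti; rewrite /extend (_ : (i == 0) = false); last lia.
by rewrite (_ : (i <= t) = false); [case: ifP|lia].
Qed.

Lemma a_of_extend : a_of x = \sum_(1 <= i < t.+1) (k i == 2).
Proof.
rewrite /a_of (count_xat (pred1 2)); apply: eq_big_nat => i it.
by rewrite extend_low.
Qed.

Lemma b_of_extend : b_of x = \sum_(1 <= i < t.+1) (k i == 3).
Proof.
rewrite /b_of (count_xat (pred1 3)); apply: eq_big_nat => i it.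
by rewrite extend_low.
Qed.

Lemma card_extend m : t < m -> m <= t.+1 + n ->
  (forall o, o \in z -> t.+1 + val o < m) ->
  \sum_(t.+1 <= i < m) (k i == 2) = #|z|.
Proof.
move=> tm mn z_bound.
transitivity (\sum_(t.+1 <= i < t.+1 + n) (k i == 2)).
  rewrite [RHS](@big_cat_nat _ _ _ m) //= [X in _ = _ + X]big1_seq ?addn0 //.
  move=> i /andP[_]; rewrite mem_index_iota => im.
  have o_lt : i - t.+1 < n by lia.
  have := extend_high (Ordinal o_lt); rewrite /= subnKC; last by lia.
  move=> ->; case: (boolP (_ \in z)) => // /z_bound /=; lia.
rewrite -[X in index_iota X]add0n big_addn addKn big_mkord -sum1_card [RHS]big_mkcond /=.
by apply: eq_bigr => o _; rewrite addnC extend_high; case: (o \in z).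
Qed.

Hypothesis x_pos : all (fun v : 'I_4 => (1 <= val v)%N) x.

Lemma xat_bounds i : 0 < i <= t -> 1 <= xat x i <= 3.
Proof.
move=> it; have i1 : i.-1 < t by lia.
rewrite /xat (nth_map ord0) // (allP x_pos) ?mem_nth //=.
by rewrite -ltnS ltn_ord.
Qed.

Lemma extend_pos i : 0 < i -> 0 < k i.
Proof.
move=> i0; have [it|it] := leqP i t.
  by rewrite extend_low ?i0 //; have := @xat_bounds i; lia.
by have := extend_high_le2 it; lia.
Qed.

Lemma excess_extend m : t < m -> m <= t.+1 + n ->
  (forall o, o \in z -> t.+1 + val o < m) ->
  \sum_(1 <= i < m) (k i).-1 = a_of x + 2 * b_of x + #|z|.
Proof.
move=> tm mn z_bound.
rewrite a_of_extend b_of_extend -(card_extend tm mn z_bound) big_distrr -big_split /=.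
rewrite (@big_cat_nat _ _ _ t.+1) //=; congr (_ + _).
  apply: eq_big_nat => i it; rewrite extend_low //.
  have : 1 <= xat x i <= 3 by apply: xat_bounds.
  by case: (xat x i) => [|[|[|[|]]]].
apply: eq_big_nat => i /andP[/extend_high_le2 + _].
by case: (k i) => [|[|[|]]].
Qed.

(** A decomposable 2 is a sum of two 1s without carry, so both indices lie below [i] and inside the
    tuple. *)
Lemma c_of_extend m : t < m ->
  c_of x = \sum_(1 <= i < t.+1) (decomposable m k i && (k i == 2)).
Proof.
move=> tm.
rewrite /c_of -sum1_count big_mkcond /index_iota subn1 /=.
rewrite big_seq [RHS]big_seq; apply: eq_bigr => i; rewrite mem_iota add1n => it.
have im : 0 < i < m by lia.
rewrite (_ : [exists _, _] = decomposable m k i && (k i == 2)); first by case: (_ && _).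
apply/existsP/andP => [[j1 /existsP[j2]]|[/(decomposableP _ im)]].
  case/and3P=> j10 j20 /and4P[/eqP ji /eqP x1 /eqP x2 xi].
  have k1 : k j1 = 1 by rewrite extend_low //; lia.
  have k2 : k j2 = 1 by rewrite extend_low //; lia.
  rewrite extend_low // xi; split=> //; apply/(decomposableP _ im).
  exists j1, j2; split; [lia|lia|left; split=> //].
  by rewrite k1 k2 extend_low // (eqP xi).
case=> j1 [j2 [/andP[j10 j1m] /andP[j20 j2m] E]] /eqP ki.
have p1 := extend_pos j10; have p2 := extend_pos j20.
have ji : j1 + j2 = i by lia.
have j1t : j1 < t.+1 by lia.
have j2t : j2 < t.+1 by lia.
exists (Ordinal j1t); apply/existsP; exists (Ordinal j2t).
by rewrite /= -!extend_low ?j10 ?j20 ?ji ?ki ?eqxx //=; lia.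
Qed.

End Extend.

(** * The bijection *)

(** The truncated predecessor makes [j = 0] give the empty tuple of Y(-1). *)
Lemma YlenE (j : nat) : Ylen (j%:Z - 1)%R = (2 * j).-1.
Proof. by case: j => [//|j]; rewrite intS [(1 + _)%R]addrC addrK mulnS. Qed.

(* [Ytuple j] is Y(k) for [j = k + 1]. *)
Definition Ytuple (j : nat) (x : seq 'I_4) : Prop :=
  [/\ size x = (2 * j).-1, all (fun v : 'I_4 => (1 <= val v)%N) x,
      forall i1 i2, 0 < i1 -> 0 < i2 -> i1 + i2 <= size x ->
        xat x i1 = 1 -> xat x i2 = 1 -> xat x (i1 + i2) != 3 &
      a_of x + 2 * b_of x <= j].

Lemma inYP (j : nat) (x : seq 'I_4) : reflect (Ytuple j x) (inY (j%:Z - 1)%R x).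
Proof.
rewrite /inY YlenE; case: eqP => [j1|jN1].
  have -> : j = 0 by lia.
  apply: (iffP eqP) => [->|[/size0nil-> //]].
  by split=> // -[|i1] [|i2].
apply: (iffP and4P) => -[].
- move=> /eqP xs xp /forallP nY le; split=> //; last by lia.
  move=> i1 i2 i10 i20 it x1 x2; have i1t : i1 < (size x).+1 by lia.
  have i2t : i2 < (size x).+1 by lia.
  have i3t : i1 + i2 < (size x).+1 by [].
  have := nY (Ordinal i1t) => /forallP/(_ (Ordinal i2t))/forallP/(_ (Ordinal i3t)) /=.
  by rewrite i10 i20 x1 x2 !eqxx addn_gt0 i10.
- move=> /eqP xs xp nY le; split=> //; last by lia.
  apply/forallP => i1; apply/forallP => i2; apply/forallP => i3.
  apply/implyP => /and4P[i10 i20 _ /eqP E]; apply/negP => /and3P[/eqP x1 /eqP x2].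
  by rewrite -E; apply/negP/nY => //; rewrite E -ltnS.
Qed.

Section Bijection.

Variables (g L : nat).
Hypothesis gL : 4 * L <= g.+1.

(** With [L = l + 1], the embedding dimension [g - l] is [g.+1 - L], and [gL] is [g >= 4l + 3]. *)
Definition target (G : {fset nat}) : Prop :=
  [/\ is_numsgp G, genus G = g & has_card (mingen G) (g.+1 - L)].

(* [2 * j + c = L + a + b] is [a + b - c = 2 k + 1 - l] with [j = k + 1], [L = l + 1]. *)
Definition admissible (j : nat) (x : seq 'I_4) : Prop :=
  Ytuple j x /\ 2 * j + c_of x = L + a_of x + b_of x.

(** In genus [g] the excess is thus [j = g + 1 - m]. *)
Lemma excess_genus m (k : nat -> nat) : (forall i, 0 < i < m -> 0 < k i) ->
  \sum_(1 <= i < m) k i = m.-1 + \sum_(1 <= i < m) (k i).-1.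
Proof.
move=> kp; have -> : m.-1 = \sum_(1 <= i < m) 1.
  by rewrite sum_nat_const_nat muln1 subn1.
by rewrite -big_split; apply: eq_big_nat => i /kp; case: (k i).
Qed.

(** For [j > 0] the [n] free positions end exactly at [m - 1], where [m = g + 1 - j]. For [j = 0]
    they reach one too far, but then [z] is empty. *)
Lemma z_bound_of_card j n (x : seq 'I_4) (z : {set 'I_n}) : n = g.+1 - 3 * j -> j <= L ->
  size x = (2 * j).-1 -> #|z| <= j ->
  forall o, o \in z -> (size x).+1 + val o < g.+1 - j.
Proof.
move=> nE jL xs zj o oz; have := ltn_ord o.
have z0 : 0 < #|z| by apply/card_gt0P; exists o.
by rewrite xs /=; lia.
Qed.

Lemma extend_decomposable j n x (z : {set 'I_n}) :
  n = g.+1 - 3 * j -> j <= L -> Ytuple j x -> #|z| = j - (a_of x + 2 * b_of x) ->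
  kunz_ineq (g.+1 - j) (extend x z) ->
  \sum_(1 <= i < g.+1 - j) decomposable (g.+1 - j) (extend x z) i =
    c_of x + b_of x + (j - (a_of x + 2 * b_of x)).
Proof.
move=> nE jL [xs xp _ ab] zc ineq; set m := g.+1 - j.
have zb : forall o, o \in z -> (size x).+1 + val o < m.
  by apply: (z_bound_of_card nE) => //; lia.
have tm : size x < m by rewrite xs /m; lia.
have mn : m <= (size x).+1 + n by rewrite xs /m; lia.
rewrite -zc (c_of_extend z xp tm) (b_of_extend x z) -(card_extend tm mn zb) xs.
apply: sum_decomposable => //; rewrite ?/m; try lia.
- by move=> i /andP[i0 _]; apply: extend_pos.
- by rewrite (excess_extend xp tm mn zb); lia.
Qed.

(** With a carry the right side is at least 3. Without one it is at least 2 and could only fail as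
    [1 + 1 < 3], which Y(k) forbids inside the tuple; past it there are no 3s. *)
Lemma extend_kunz_ineq j n x (z : {set 'I_n}) m :
  Ytuple j x -> kunz_ineq m (extend x z).
Proof.
move=> [_ xp nY _].
have le3 i : 0 < i -> extend x z i <= 3 /\ (size x < i -> extend x z i <= 2).
  move=> i0; have [it|it] := leqP i (size x).
    by rewrite extend_low ?i0 //; have := xat_bounds xp (i := i); lia.
  by have := extend_high_le2 z it; lia.
have kp i : 0 < i -> 0 < extend x z i by apply: extend_pos.
split=> [i1 i2 i10 i20 im|i1 i2 i1m i2m im]; last first.
  have [|] := le3 (i1 + i2 - m); first lia.
  by have := kp i1; have := kp i2; lia.
have [] := le3 (i1 + i2); first lia.
have := kp _ i10; have := kp _ i20.
have [it|it] := leqP (i1 + i2) (size x); last by lia.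
have := nY i1 i2 i10 i20 it; rewrite !extend_low; lia.
Qed.

Definition sgp_of (j n : nat) (x : seq 'I_4) (z : {set 'I_n}) : {fset nat} :=
  gap_set (g.+1 - j) (extend x z).

Lemma kunz_sgp_of j n x (z : {set 'I_n}) :
  j <= L -> Ytuple j x -> kunz (g.+1 - j) (extend x z) (sgp_of j x z).
Proof.
move=> jL [_ xp _ _]; apply: kunz_gap_set => //; first lia.
by move=> i /andP[i0 _]; apply: extend_pos.
Qed.

Lemma sgp_of_target j n x (z : {set 'I_n}) :
  n = g.+1 - 3 * j -> j <= L -> admissible j x ->
  #|z| = j - (a_of x + 2 * b_of x) -> target (sgp_of j x z).
Proof.
move=> nE jL [Yx cE] zc; have kG := kunz_sgp_of z jL Yx.
have ineq := extend_kunz_ineq z (g.+1 - j) Yx.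
have nG : is_numsgp (sgp_of j x z) by apply/(kunz_numsgp kG).
case: (Yx) => xs xp _ ab; split=> //.
  rewrite (kunz_genus kG) excess_genus; last first.
    by move=> i /andP[i0 _]; apply: extend_pos.
  rewrite (excess_extend xp) ?xs; try lia.
  by rewrite -xs; apply: (z_bound_of_card nE) => //; lia.
have := kunz_embdim kG nG; rewrite extend_decomposable //.
(* Here [m - d] is [g + 1 - 2j - c + a + b], which is [g + 1 - L] by admissibility. *)
by congr has_card; lia.
Qed.

Lemma target_sgp_of G : target G ->
  exists j x (z : {set 'I_(g.+1 - 3 * j)}),
    [/\ j <= L, admissible j x, #|z| = j - (a_of x + 2 * b_of x) & G = sgp_of j x z].
Proof.
case=> nG gG eG; have [m [k kG]] := numsgp_kunz nG.
have := has_card_unique eG (kunz_embdim kG nG).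
have := kunz_genus kG; rewrite gG.
have /(kunz_numsgp kG) ineq := nG; case: (kG) => m0 k0 kp _.
rewrite (excess_genus kp); set j := \sum_(1 <= i < m) (k i).-1 => gE dE.
have mE : m = g.+1 - j by lia.
(* The embedding dimension is at most [m], so [g + 1 - L <= g + 1 - j]. *)
have jL : j <= L.
  have dm : \sum_(1 <= i < m) decomposable m k i <= m.-1.
    rewrite -subn1 -[_ - _]muln1 -sum_nat_const_nat.
    by apply: leq_sum => i _; case: (decomposable _ _ _).
  lia.
(* Indeed [m = g + 1 - j >= 4L - j >= 3j]. *)
have jm : 3 * j <= m by lia.
set n := g.+1 - 3 * j.
pose x : seq 'I_4 := mkseq (fun i => inord (k i.+1)) (2 * j).-1.
(* The bound by [m] matters for [j = 0]: the last position is then [m], where [k] is arbitrary. *)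
pose z := [set o : 'I_n | (k ((2 * j).-1.+1 + o) == 2) && ((2 * j).-1.+1 + o < m)].
have xs : size x = (2 * j).-1 by rewrite size_mkseq.
have tm : size x < m by rewrite xs; lia.
have mn : m <= (size x).+1 + n by rewrite xs /n; lia.
have xatE i : 0 < i <= size x -> xat x i = k i.
  move=> it; rewrite /xat (nth_map ord0); last lia.
  rewrite nth_mkseq -?xs; last lia.
  rewrite /= inordK prednK; try lia.
  by rewrite ltnS; apply: (kunz_le3 kp ineq erefl jm); lia.
have xp : all (fun v : 'I_4 => (1 <= val v)%N) x.
  apply/(all_nthP ord0) => i it; have := xatE i.+1; rewrite /xat (nth_map ord0) //= => -> //.
  by apply: kp; lia.
(* Past the tuple only 1s and 2s occur, so the positions of the 2s recover [k]. *)
have kE : {in gtn m, k =1 extend x z}.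
  move=> i; rewrite inE => im; have [->|i0] := posnP i; first by rewrite k0.
  have [it|it] := leqP i (size x); first by rewrite extend_low ?i0 // xatE ?i0.
  have on : i - (size x).+1 < n by lia.
  have := extend_high x z (Ordinal on); rewrite /= subnKC // => ->.
  rewrite inE /= -xs subnKC // im andbT.
  have := kunz_le3 kp ineq erefl jm (i := i); have := kunz_eq3_lt kp ineq erefl jm (i := i).
  have := kp i; rewrite i0 im; case: (k i) => [|[|[|[|]]]] //=; lia.
have zb : forall o, o \in z -> (size x).+1 + val o < m.
  by move=> o; rewrite inE xs => /andP[].
have jE : j = a_of x + 2 * b_of x + #|z|.
  rewrite -(excess_extend xp tm mn zb); apply: eq_big_nat => i /andP[_ im].
  by rewrite kE.
have Yx : Ytuple j x.
  split=> //; last by lia.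
  move=> i1 i2 i10 i20 it; rewrite !xatE; try lia.
  by have := ineq.1 i1 i2; lia.
have kG' := kunz_congr kE kG.
have zc : #|z| = j - (a_of x + 2 * b_of x) by lia.
exists j, x, z; split=> //.
- split=> //.
  (* Computing the embedding dimension from [x] and [z] yields the linear condition of
     admissibility. *)
  have := extend_decomposable (erefl n) jL Yx zc (extend_kunz_ineq z _ Yx).
  rewrite -mE => dE'.
  have := has_card_unique eG (kunz_embdim kG' nG); rewrite dE'; lia.
- by rewrite /sgp_of -mE; apply: kunz_gap_setE.
Qed.

(** The multiplicity gives [j], and the first [2 * j - 1] coordinates give the tuple. The two sets
    may live over different ordinals, so only their coordinates are compared. *)
Lemma sgp_of_inj j1 n1 x1 (z1 : {set 'I_n1}) j2 n2 x2 (z2 : {set 'I_n2}) :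
  j1 <= L -> j2 <= L -> Ytuple j1 x1 -> Ytuple j2 x2 ->
  sgp_of j1 x1 z1 = sgp_of j2 x2 z2 ->
  [/\ j1 = j2, x1 = x2 & {in gtn (g.+1 - j1), extend x1 z1 =1 extend x2 z2}].
Proof.
move=> j1L j2L Y1 Y2 E; have K1 := kunz_sgp_of z1 j1L Y1.
have K2 := kunz_sgp_of z2 j2L Y2; rewrite -E in K2.
have [mm kk] := kunz_unique K1 K2.
have jj : j1 = j2 by lia.
case: Y1 Y2 => s1 _ _ _ [s2 _ _ _]; split=> //.
have ss : size x1 = size x2 by rewrite s1 s2 jj.
apply: (eq_from_nth (x0 := ord0) ss) => i it; apply: val_inj.
have := kk i.+1; rewrite !extend_low -?ss // /xat /= !(nth_map ord0) -?ss //.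
by apply; rewrite inE; lia.
Qed.

Lemma has_card_sgp_of j x : j <= L -> Ytuple j x ->
  has_card (fun G => exists2 z : {set 'I_(g.+1 - 3 * j)},
              #|z| = j - (a_of x + 2 * b_of x) & G = sgp_of j x z)
           'C(g.+1 - 3 * j, j - (a_of x + 2 * b_of x)).
Proof.
move=> jL Yx; apply: has_card_image.
  have sub (z1 z2 : {set 'I_(g.+1 - 3 * j)}) :
      #|z1| = j - (a_of x + 2 * b_of x) -> sgp_of j x z1 = sgp_of j x z2 ->
      z1 \subset z2.
    move=> c1 /(sgp_of_inj jL jL Yx Yx)[_ _ kk]; apply/subsetP => o oz.
    case: Yx => xs _ _ _.
    (* An element of [z1] shows as a 2 at a position below [m], hence lies in [z2]. *)
    have := kk ((size x).+1 + val o); rewrite !extend_high oz inE.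
    rewrite (z_bound_of_card (erefl _) jL xs _ oz) ?c1 ?leq_subr //.
    by move/(_ isT); case: (o \in z2).
  by move=> z1 z2 c1 c2 E; apply/eqP; rewrite eqEsubset !sub.
exists (enum [set z : {set 'I_(g.+1 - 3 * j)} | #|z| == j - (a_of x + 2 * b_of x)]).
split; first exact: enum_uniq.
  by move=> z; rewrite mem_enum inE; split=> [->|/eqP].
by rewrite -cardE card_draws card_ord.
Qed.

End Bijection.

(** * Summation over the excess and the tuples *)

Local Open Scope ring_scope.

Theorem theorem8p10 (l : int) (g : nat) :
  (-1 <= l)%R -> (4 * l + 3 <= g%:Z)%R ->
  has_card (fun G : {fset nat} =>
              [/\ is_numsgp G, genus G = g &
                  exists n : nat, embdim_is G n /\ n%:Z = g%:Z - l])
           (rhs810 l g).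
Proof.
(* Shifting to [j = k + 1] and [L = l + 1] makes all indices natural numbers. *)
move=> l_ge gl; pose L := absz (l + 1).
have lE : l = L%:Z - 1 by lia.
have gL : (4 * L <= g.+1)%N by lia.
pose adm (j : nat) (x : (Ylen (j%:Z - 1)).-tuple 'I_4) :=
  inY (j%:Z - 1) x &&
  ((a_of x)%:Z + (b_of x)%:Z - (c_of x)%:Z == 2 * (j%:Z - 1) + 1 - l).
have admP j (x : (Ylen (j%:Z - 1)).-tuple 'I_4) : reflect (admissible L j x) (adm j x).
  by apply: (iffP andP) => -[/inYP Yx cE]; split=> //; first [apply/inYP|lia].
(* Admissibility is repeated in [P] because disjointness of the union needs it. *)
pose P (j : nat) (x : (Ylen (j%:Z - 1)).-tuple 'I_4) (G : {fset nat}) :=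
  adm j x /\ exists2 z : {set 'I_(g.+1 - 3 * j)},
               #|z| = (j - (a_of x + 2 * b_of x))%N & G = sgp_of g j x z.
pose Q (j : nat) (G : {fset nat}) := exists x, [/\ x \in index_enum _, adm j x & P j x G].
apply: (@has_card_iff _
  (fun G => exists j, [/\ j \in index_iota 0 L.+1, true & Q j G])).
  move=> G; transitivity (target g L G).
    split=> [[j [+ _ [x [_ _ [/admP ax [z zc ->]]]]]]|].
      by rewrite mem_index_iota => jL; apply: sgp_of_target.
    case/(target_sgp_of gL) => j [x [z [jL ax zc ->]]].
    have xs : size x == Ylen (j%:Z - 1) by case: ax => -[-> _ _ _] _; rewrite YlenE.
    exists j; split=> //; first by rewrite mem_index_iota.
    have ax' : adm j (Tuple xs) by apply/admP.
    by exists (Tuple xs); split=> //; split=> //; exists z.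
  split=> [[nG gG eG]|[nG gG [n [eG nE]]]]; split=> //.
    by exists (g.+1 - L)%N; split=> //; lia.
  by rewrite (_ : (g.+1 - L)%N = n) //; lia.
(* The bound [a + 2b <= k + 1] of Y(k) makes [absz] and truncated subtraction agree. *)
have rE (j a b : nat) : (a + 2 * b <= j)%N ->
    absz (j%:Z - 1 + 1 - a%:Z - 2 * b%:Z)%R = (j - (a + 2 * b))%N by lia.
rewrite /rhs810; apply: has_card_bigU => [|j|j1 j2 G]; first exact: iota_uniq.
  rewrite mem_index_iota => jL _.
  apply: has_card_bigU => [|x _ ax|x1 x2 G _ _]; first exact: index_enum_uniq.
    have [Yx _] := admP _ _ ax.
    have := has_card_sgp_of gL jL Yx.
    case: (Yx) => _ _ _ ab.
    rewrite (_ : absz (g%:Z - 3 * (j%:Z - 1) - 2)%R = (g.+1 - 3 * j)%N); last lia.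
    rewrite rE //.
    by apply: has_card_iff => G; split=> [|[]].
  case=> /admP[Y1 _] [z1 _ ->] [/admP[Y2 _] [z2 _ E]].
  by have [_ /val_inj] := sgp_of_inj gL jL jL Y1 Y2 E.
rewrite !mem_index_iota => j1L j2L.
case=> x1 [_ _ [/admP[Y1 _] [z1 _ ->]]] [x2 [_ _ [/admP[Y2 _] [z2 _ E]]]].
by have [] := sgp_of_inj gL j1L j2L Y1 Y2 E.
Qed.
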